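(* A maximum $3\times 3$ board contains six prisoners, i.e. $P(3)=6$.
   Context: A configuration on an $n\times n$ board assigns to each of the $n^2$ squares exactly one occupant, either a prisoner or a guard. Two distinct squares are adjacent if one is directly above, below, to the left, to the right, or diagonal to the other (king-move adjacency). A configuration is valid (a valid board) if every square occupied by a prisoner is adjacent to at least as many squares occupied by guards as squares occupied by (other) prisoners. A maximum configuration (maximum board) is a valid board that has the greatest number of prisoners among all valid boards on the $n\times n$ board. $P(n)$ denotes the number of prisoners in a maximum configuration on the $n\times n$ board. *)

(* Defs.v *)
From mathcomp Require Import all_boot.

Set Implicit Arguments.
Unset Strict Implicit.
Unset Printing Implicit Defensive.

Definition square (n : nat) : finType := ('I_n * 'I_n)%type.

Definition close (a b : nat) : bool := (a <= b.+1) && (b <= a.+1).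

(* Distinct squares at king-move distance one: the row indices differ by at
   most one, and so do the column indices. *)
Definition adjacent n (s t : square n) : bool :=
  [&& s != t, close s.1 t.1 & close s.2 t.2].

Definition occupant : finType := bool.
Definition prisoner : occupant := true.
Definition guard : occupant := false.

Definition configuration (n : nat) : finType := {ffun square n -> occupant}.

Definition adjacent_count n (c : configuration n) (s : square n)
    (o : occupant) : nat :=
  #|[set t : square n | adjacent s t && (c t == o)]|.

Definition valid n (c : configuration n) : bool :=
  [forall s : square n, (c s == prisoner) ==>
     (adjacent_count c s prisoner <= adjacent_count c s guard)].

Definition prisoners n (c : configuration n) : nat :=
  #|[set s : square n | c s == prisoner]|.

Definition maximum n (c : configuration n) : Prop :=
  valid c /\ forall d : configuration n, valid d -> prisoners d <= prisoners c.

Definition P (n : nat) : nat :=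
  \max_(c : configuration n | valid c) prisoners c.

(* [P n] is attained: the all-guard board is valid, so the maximum is taken
   over a nonempty family. *)
Lemma maximum_exists n : exists c : configuration n, maximum c.
Proof.
have v0 : valid ([ffun=> guard] : configuration n).
  by apply/forallP => s; rewrite ffunE.
case: (@arg_maxnP _ [ffun=> guard] (@valid n) (@prisoners n) v0) => c vc cmax.
by exists c.
Qed.

Lemma maximum_P n (c : configuration n) : maximum c -> prisoners c = P n.
Proof.
move=> [vc cmax]; apply/eqP; rewrite eqn_leq (leq_bigmax_cond _ vc) /=.
by apply/bigmax_leqP.
Qed.

(* Main.v *)
(** A prisoner has at least as many guard neighbours as prisoner neighbours, so
    its number of neighbours is at most twice the number of guards.  On the
    3 x 3 board every non-corner square has at least five neighbours.  With at
    most two guards, all five non-corner squares would thus be guards, which is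
    absurd; hence there are at least three guards.  Three guards filling the
    middle row give a valid board. *)
Require Import Defs.
From mathcomp Require Import all_boot.

(** Turns a cardinality on a concrete board into a double sum that evaluates once the ordinals are
    enumerated. *)
Lemma card_square n (p : pred (square n)) :
  #|[set s | p s]| = \sum_(i < n) \sum_(j < n) p (i, j).
Proof.
rewrite cardsE -sum1_card big_mkcond pair_bigA /=.
by apply: eq_bigr => -[i j] _; rewrite unfold_in; case: (p _).
Qed.

Lemma prisoner_degree n (c : configuration n) (s : square n) :
  valid c -> c s = prisoner ->
  #|[set t | adjacent s t]| <= (#|[set t | c t == guard]|).*2.
Proof.
move=> /forallP/(_ s) vs cs; move: vs; rewrite cs eqxx /= => vs.
have -> : #|[set t | adjacent s t]|
    = adjacent_count c s prisoner + adjacent_count c s guard.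
  rewrite -(cardsID [set t | c t == prisoner]); congr (_ + _);
    apply: eq_card => t; rewrite !inE //.
  by rewrite andbC; case: (c t).
have le_guard : adjacent_count c s guard <= #|[set t | c t == guard]|.
  by apply/subset_leq_card/subsetP => t; rewrite !inE => /andP[].
by rewrite -addnn; apply: leq_add => //; apply: leq_trans le_guard.
Qed.

Lemma prisoners_guards n (c : configuration n) :
  prisoners c + #|[set s | c s == guard]| = n * n.
Proof.
rewrite -[in RHS](card_ord n) -card_prod -(cardsC [set s | c s == prisoner]).
by congr (_ + _); apply: eq_card => s; rewrite !inE; case: (c s).
Qed.

Definition non_corner (s : square 3) : bool :=
  (s.1 == 1 :> nat) || (s.2 == 1 :> nat).

(** Edge midpoints have five neighbours, the centre eight. *)
Lemma degree_non_corner (s : square 3) :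
  non_corner s -> 5 <= #|[set t | adjacent s t]|.
Proof.
rewrite card_square !big_ord_recl !big_ord0.
by case: s => -[[|[|[|//]]] ?] [[|[|[|//]]] ?].
Qed.

Lemma card_non_corner : #|[set s | non_corner s]| = 5.
Proof. by rewrite card_square !big_ord_recl !big_ord0. Qed.

Lemma guards3_ge3 (c : configuration 3) :
  valid c -> 3 <= #|[set s | c s == guard]|.
Proof.
move=> vc; rewrite leqNgt; apply/negP => few.
suff /subset_leq_card : [set s | non_corner s] \subset [set s | c s == guard].
  by rewrite card_non_corner => /leq_trans/(_ few).
apply/subsetP => s; rewrite !inE => /degree_non_corner deg.
case cs: (c s) => //; have := leq_trans deg (prisoner_degree _ _ _ vc cs).
(* With at most two guards, a prisoner at [s] would force [5 <= 4]. *)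
by move: few; case: #|_| => [|[|[|]]].
Qed.

Lemma prisoners3_le6 (c : configuration 3) : valid c -> prisoners c <= 6.
Proof.
move=> /guards3_ge3 ge3.
(* [6 + 3] and [3 * 3] agree by computation. *)
by rewrite -(leq_add2r 3) -[6 + 3](prisoners_guards _ c) leq_add2l.
Qed.

Definition middle_row_guarded : configuration 3 :=
  [ffun s : square 3 => s.1 != 1 :> nat].

(** Guard neighbours outnumber prisoner neighbours by one at every prisoner: two against one in a
    corner, three against two at the middle of an outer row. *)
Lemma middle_row_guarded_valid : valid middle_row_guarded.
Proof.
apply/forallP => s; rewrite /adjacent_count !card_square.
rewrite !big_ord_recl !big_ord0 !ffunE.
by case: s => -[[|[|[|//]]] ?] [[|[|[|//]]] ?].
Qed.

Lemma prisoners_middle_row_guarded : prisoners middle_row_guarded = 6.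
Proof.
by rewrite /prisoners card_square !big_ord_recl !big_ord0 !ffunE.
Qed.

Theorem theorem2p2 :
  (forall c : configuration 3, maximum c -> prisoners c = 6) /\ P 3 = 6.
Proof.
have max6 (c : configuration 3) : maximum c -> prisoners c = 6.
  move=> [vc cmax]; apply/eqP; rewrite eqn_leq prisoners3_le6 //=.
  by rewrite -prisoners_middle_row_guarded cmax // middle_row_guarded_valid.
split=> //; have [c cmax] := maximum_exists 3.
by rewrite -(maximum_P cmax) max6.
Qed.
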